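(* Let $X$ be a Banach space with the Daugavet property, let $Y$ be a Banach space and let $T:X\to Y$ be a hereditary-SCD-operator. Then $T$ is narrow.
   Context: $S_X,B_X$ are the unit sphere and ball of $X$. $X$ has the Daugavet property if every rank-one bounded operator $T$ on $X$ satisfies $\|\mathrm{Id}+T\|=1+\|T\|$. A slice of a convex bounded set $A$ is $S(A,x^*,\varepsilon)=\{x\in A:\ \mathrm{Re}\,x^*(x)>\sup\mathrm{Re}\,x^*(A)-\varepsilon\}$; $A$ is an SCD set if there is a sequence $(S_n)$ of slices of $A$ such that $A\subseteq\overline{\mathrm{conv}}(B)$ for every $B\subseteq A$ intersecting all the $S_n$. A bounded linear $T:X\to Y$ is a hereditary-SCD-operator if every convex subset of $T(B_X)$ is an SCD set. $T$ is narrow if for every $x,y\in S_X$, every $\varepsilon>0$ and every slice $S$ of $B_X$ containing $y$, there is $z\in S$ with $\|x+z\|\geq 2-\varepsilon$ and $\|Ty-Tz\|<\varepsilon$. *)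

(* Defs.v *)
From HB Require Import structures.
From mathcomp Require Import all_boot all_order all_algebra.
From mathcomp Require Import complex.
From mathcomp Require Import all_classical all_reals all_analysis.
Set Implicit Arguments. Unset Strict Implicit. Unset Printing Implicit Defensive.
Import Order.TTheory GRing.Theory Num.Theory.
Import numFieldNormedType.Exports.
Local Open Scope classical_set_scope.
Local Open Scope ring_scope.

(* Scalars: a field K (either R or C = R[i]) together with the map
   re : K -> R taking the real part (re = id for K = R, re = complex.Re
   for K = R[i]).  Norms of a normed K-module take values in K (real
   values), so re (`|x|) is the norm as an element of R. *)
Section Defs.
Variables (R : realType) (K : numFieldType) (re : K -> R).

Definition is_linear (X Y : lmodType K) (T : X -> Y) : Prop :=
  forall (a : K) (x y : X), T (a *: x + y) = a *: T x + T y.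

Definition is_linear_functional (X : lmodType K) (f : X -> K) : Prop :=
  forall (a : K) (x y : X), f (a *: x + y) = a * f x + f y.

Definition bounded_linear (X Y : normedModType K) (T : X -> Y) : Prop :=
  is_linear T /\ continuous T.

Definition dual_elt (X : normedModType K) (f : X -> K) : Prop :=
  is_linear_functional f /\ continuous f.

Definition nrm (X : normedModType K) (x : X) : R := re `|x|.

Definition unit_ball (X : normedModType K) : set X := [set x | nrm x <= 1].
Definition unit_sphere (X : normedModType K) : set X := [set x | nrm x = 1].

Definition opnorm (X Y : normedModType K) (T : X -> Y) : R :=
  sup [set nrm (T x) | x in @unit_ball X].

Definition rank_one (X Y : normedModType K) (T : X -> Y) : Prop :=
  exists2 y0 : Y, y0 != 0 &
    (forall x, exists a : K, T x = a *: y0) /\ (exists x, T x != 0).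

Definition daugavet_property (X : normedModType K) : Prop :=
  forall T : X -> X, bounded_linear T -> rank_one T ->
    opnorm (fun x => x + T x) = 1 + opnorm T.

Definition slice (Y : normedModType K) (A : set Y) (f : Y -> K) (eps : R)
  : set Y :=
  [set x | A x /\ re (f x) > sup [set re (f a) | a in A] - eps].

Definition is_slice (Y : normedModType K) (A S : set Y) : Prop :=
  exists f : Y -> K, exists eps : R,
    [/\ dual_elt f, 0 < eps & S = slice A f eps].

Definition convex_set (Y : lmodType K) (A : set Y) : Prop :=
  forall x y, A x -> A y -> forall t : K, 0 <= t -> t <= 1 ->
    A (t *: x + (1 - t) *: y).

Definition conv_hull (Y : lmodType K) (B : set Y) : set Y :=
  [set x | exists n : nat, exists c : 'I_n -> K, exists b : 'I_n -> Y,
     [/\ forall i, 0 <= c i, \sum_(i < n) c i = 1, forall i, B (b i)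
       & x = \sum_(i < n) c i *: b i]].

Definition closed_conv_hull (Y : normedModType K) (B : set Y) : set Y :=
  closure (conv_hull B).

(* SCD set (for a convex bounded set A) *)
Definition SCD_set (Y : normedModType K) (A : set Y) : Prop :=
  exists S : nat -> set Y, (forall n, is_slice A (S n)) /\
    (forall B : set Y, B `<=` A -> (forall n, B `&` S n !=set0) ->
       A `<=` closed_conv_hull B).

Definition hereditary_SCD_operator (X Y : normedModType K) (T : X -> Y)
  : Prop :=
  bounded_linear T /\
  forall A : set Y, A `<=` T @` @unit_ball X -> convex_set A -> SCD_set A.

Definition narrow (X Y : normedModType K) (T : X -> Y) : Prop :=
  forall x y : X, @unit_sphere X x -> @unit_sphere X y ->
  forall eps : R, 0 < eps ->
  forall S : set X, is_slice (@unit_ball X) S -> S y ->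
  exists2 z, S z & nrm (x + z) >= 2 - eps /\ nrm (T y - T z) < eps.

End Defs.

(* Main.v *)
Require Import Defs.
From HB Require Import structures.
From mathcomp Require Import all_boot all_order all_algebra.
From mathcomp Require Import complex.
From mathcomp Require Import all_classical all_reals all_analysis.
From mathcomp Require Import ring lra.
Import Order.TTheory GRing.Theory Num.Theory.
Import numFieldNormedType.Exports.
Local Open Scope classical_set_scope.
Local Open Scope ring_scope.
Set Implicit Arguments. Unset Strict Implicit. Unset Printing Implicit Defensive.

(** Take a slice [S'] of the ball, slightly smaller than the given one but still
    containing [y], and slices [S_n] determining [T(S')].  Choosing
    [z_n] in [S'] with [T z_n] in [S_n] and almost additive norms, one gets
    [||x + z_0 + ... + z_n|| >= n + 2 - eps] for all [n], hence
    [||x + z|| >= 2 - eps] for every convex combination [z] of the [z_n]; by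
    the choice of the [S_n], [T y] is a limit of the images of such [z].
    The set from which [z_n] is taken is an intersection of two slices of the
    ball rather than a slice; there the Daugavet property is applied to two
    slices, a convex combination of which lies in the intersection. *)

(* Treats [K = R] and [K = R[i]] at once; [inc] is the inclusion of [R]. *)
Record real_part (R : realType) (K : numFieldType)
    (inc : {rmorphism R -> K}) (re : K -> R) : Prop := RealPart {
  rpD : forall a b, re (a + b) = re a + re b;
  rpM : forall r a, re (inc r * a) = r * re a;
  rp1 : re 1 = 1;
  rp_le_norm : forall a, re a <= re `|a|;
  rpK : forall a, 0 <= a -> inc (re a) = a;
  rp_ge0 : forall a, 0 <= a -> 0 <= re a;
  inc_ge0 : forall r, 0 <= r -> 0 <= inc r }.

(** * Arithmetic of the real part and of the inclusion of the reals *)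

Section Narrow.
Context {R : realType} {K : numFieldType} {inc : {rmorphism R -> K}}
  {re : K -> R}.
Hypothesis hre : real_part inc re.

Lemma rp_inc r : re (inc r) = r.
Proof. by rewrite -[inc r]mulr1 (rpM hre) (rp1 hre) mulr1. Qed.

Lemma rp0 : re 0 = 0.
Proof. by rewrite -(rmorph0 inc) rp_inc. Qed.

Lemma inc_gt0 r : 0 < r -> 0 < inc r.
Proof.
by move=> r0; rewrite lt0r fmorph_eq0 (inc_ge0 hre) ?(ltW r0)// gt_eqF.
Qed.

Lemma rp_gt0 a : 0 < a -> 0 < re a.
Proof.
move=> a0; rewrite lt0r (rp_ge0 hre) ?(ltW a0)// andbT; apply/eqP => ra0.
by have := rpK hre (ltW a0); rewrite ra0 rmorph0 => a00; rewrite -a00 ltxx in a0.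
Qed.

Lemma rpB a b : re (a - b) = re a - re b.
Proof. by apply/eqP; rewrite eq_sym subr_eq -(rpD hre) subrK. Qed.

Lemma rp_le a b : a <= b -> re a <= re b.
Proof. by move=> ab; rewrite -subr_ge0 -rpB (rp_ge0 hre)// subr_ge0. Qed.

Lemma rp_lt a b : a < b -> re a < re b.
Proof. by move=> ab; rewrite -subr_gt0 -rpB rp_gt0// subr_gt0. Qed.

Lemma rp_sum (I : Type) (s : seq I) (P : pred I) (F : I -> K) :
  re (\sum_(i <- s | P i) F i) = \sum_(i <- s | P i) re (F i).
Proof. exact: (big_morph re (rpD hre) rp0). Qed.

(** * Real-valued norms *)

Section Norm.
Variable X : normedModType K.
Implicit Types x y : X.
Local Notation nrm := (nrm re).

Lemma inc_nrm x : inc (nrm x) = `|x|.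
Proof. by rewrite (rpK hre). Qed.

Lemma nrm_gt0 x : x != 0 -> 0 < nrm x.
Proof. by move=> x0; apply: rp_gt0; rewrite normr_gt0. Qed.

Lemma nrm0 : nrm (0 : X) = 0.
Proof. by rewrite /Defs.nrm normr0 rp0. Qed.

Lemma nrmD x y : nrm (x + y) <= nrm x + nrm y.
Proof. by rewrite -(rpD hre); apply: rp_le; exact: ler_normD. Qed.

Lemma nrmN x : nrm (- x) = nrm x.
Proof. by rewrite /Defs.nrm normrN. Qed.

Lemma nrmZ a x : nrm (a *: x) = re `|a| * nrm x.
Proof. by rewrite /Defs.nrm normrZ -{1}(rpK hre (normr_ge0 a)) (rpM hre). Qed.

Lemma nrmZ_ge0 a x : 0 <= a -> nrm (a *: x) = re a * nrm x.
Proof. by move=> a0; rewrite nrmZ ger0_norm. Qed.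

Lemma nrmD_ge x y : nrm x - nrm y <= nrm (x + y).
Proof. by have := nrmD (x + y) (- y); rewrite nrmN addrK lerBlDr. Qed.

Lemma nrm_sum (I : Type) (s : seq I) (P : pred I) (F : I -> X) :
  nrm (\sum_(i <- s | P i) F i) <= \sum_(i <- s | P i) nrm (F i).
Proof.
elim/big_ind2 : _ => [|x1 r1 x2 r2 h1 h2|//]; first by rewrite nrm0.
by apply: (le_trans (nrmD _ _)); exact: lerD.
Qed.

Lemma closure_nrm (A : set X) x (e : R) : closure A x -> 0 < e ->
  exists2 y, A y & nrm (x - y) < e.
Proof.
move=> Ax e0.
have [y [Ay xy]] := Ax _ (nbhsx_ballx x (inc e) (inc_gt0 e0)).
exists y => //; rewrite -[e]rp_inc; apply: rp_lt.
by rewrite -ball_normE in xy.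
Qed.

Lemma unit_ball_conv x y (c : R) : 0 <= c -> c <= 1 ->
  unit_ball re x -> unit_ball re y ->
  unit_ball re (inc c *: x + inc (1 - c) *: y).
Proof.
rewrite /unit_ball /= => c0 c1 x1 y1.
apply: (le_trans (nrmD _ _)); have d0 : 0 <= 1 - c by lra.
by rewrite !nrmZ_ge0 ?(inc_ge0 hre)// !rp_inc; nra.
Qed.

End Norm.

(** * Linear maps and their boundedness on the unit ball *)

Section Linear.
Variables (X Y : normedModType K) (T : X -> Y).
Hypothesis linT : is_linear T.

Lemma is_linear0 : T 0 = 0.
Proof. by have := linT (-1) 0 0; rewrite scaler0 addr0 scaleN1r addNr. Qed.

Lemma is_linearZ a x : T (a *: x) = a *: T x.
Proof. by have := linT a x 0; rewrite !addr0 is_linear0 addr0. Qed.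

Lemma is_linearD x y : T (x + y) = T x + T y.
Proof. by rewrite -[x]scale1r linT !scale1r. Qed.

Lemma is_linear_sum (I : Type) (s : seq I) (P : pred I) (F : I -> X) :
  T (\sum_(i <- s | P i) F i) = \sum_(i <- s | P i) T (F i).
Proof. exact: (big_morph T is_linearD is_linear0). Qed.

(** Continuity at 0 gives a radius [d] below which [T] has norm less than 1; scaling the unit ball
    by [d / 2] yields the bound [(d / 2)^-1]. *)
Lemma continuous_linear_ball : continuous T ->
  exists2 M : R, 0 < M & forall x, unit_ball re x -> nrm re (T x) <= M.
Proof.
move=> /(_ 0) /cvgrPdist_lt/(_ _ ltr01); rewrite is_linear0.
move=> /nbhs_normP[d /= d0 Td].
exists (re (d / 2)^-1).
  by apply: rp_gt0; rewrite invr_gt0 divr_gt0.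
move=> x x1; apply: rp_le.
have s0 : 0 < d / 2 by rewrite divr_gt0.
have x1' : `|x| <= 1.
  rewrite -inc_nrm -subr_ge0 -(rmorph1 inc) -rmorphB (inc_ge0 hre)//.
  by rewrite subr_ge0.
have := Td ((d / 2) *: x); rewrite /ball_ /= !sub0r !normrN is_linearZ.
rewrite (normrZ _ x) (normrZ _ (T x)).
rewrite (gtr0_norm s0) => Tdx; rewrite -[leRHS]mulr1 ler_pdivlMl//.
apply/ltW; apply: Tdx.
rewrite (@le_lt_trans _ _ (d / 2))//; first by rewrite ler_piMr// ltW.
by rewrite ltr_pdivrMr// ltr_pMr// ltr1n.
Qed.

End Linear.

(** * Real parts of continuous functionals *)

Section Functional.
Variable X : normedModType K.
Implicit Types (f g : X -> K) (x : X).

Lemma dual_eltZ f a x : dual_elt f -> f (a *: x) = a * f x.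
Proof. by move=> [lf _]; exact: (@is_linearZ X K^o f lf). Qed.

Lemma dual_elt_ball f : dual_elt f ->
  exists2 M : R, 0 < M & forall x, unit_ball re x -> re `|f x| <= M.
Proof. by move=> [lf cf]; exact: (@continuous_linear_ball X K^o f lf cf). Qed.

Lemma rp_dual_conv f x y (c : R) : dual_elt f ->
  re (f (inc c *: x + inc (1 - c) *: y)) = c * re (f x) + (1 - c) * re (f y).
Proof.
by move=> df; rewrite (proj1 df) (dual_eltZ _ _ df) (rpD hre) !(rpM hre).
Qed.

Lemma rp_ge_norm a : - re `|a| <= re a.
Proof.
by have := rp_le_norm hre (- a); rewrite normrN -[- a]sub0r rpB rp0; lra.
Qed.

Lemma dual_elt_comb f g (r : R) : dual_elt f -> dual_elt g ->
  dual_elt (fun x => f x + inc r * g x).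
Proof.
move=> [lf cf] [lg cg]; split=> [a x y|x].
  by rewrite lf lg; ring.
apply: (@cvgD K K^o X); first exact: cf.
by apply: (@cvgM K X); [exact: cvg_cst|exact: cg].
Qed.

Lemma dual_elt_comp (Y : normedModType K) (T : X -> Y) (f : Y -> K) :
  bounded_linear T -> dual_elt f -> dual_elt (f \o T).
Proof.
move=> [lT cT] [lf cf]; split=> [a x y /=|x]; first by rewrite lT lf.
by apply: continuous_comp; [exact: cT|exact: cf].
Qed.

End Functional.

(** * The Daugavet property on one slice, then on two *)

Section Daugavet.
Variable X : normedModType K.
Implicit Types (f g h : X -> K) (u v x z : X).
Local Notation nrm := (nrm re).
Local Notation B := (@unit_ball R K re X).

Lemma unit_ball0 : B 0.
Proof. by rewrite /unit_ball /= nrm0. Qed.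

Lemma nrm_normalize x : x != 0 -> nrm (inc (nrm x)^-1 *: x) = 1.
Proof.
move=> x0; have r0 := nrm_gt0 x0.
by rewrite nrmZ_ge0 ?(inc_ge0 hre) ?invr_ge0 ?ltW// rp_inc mulVf// gt_eqF.
Qed.

Lemma has_sup_ball (Y : normedModType K) (T : X -> Y) (M : R) :
  (forall x, B x -> nrm (T x) <= M) -> has_sup [set nrm (T x) | x in B].
Proof.
move=> TM; split; first by exists (nrm (T 0)), 0 => //; exact: unit_ball0.
by exists M => _ [x Bx <-]; exact: TM.
Qed.

(** The operator [T u = (f u / N) v], with [N] the norm of [f], has norm [r = nrm v]. A point [u] at
    which [Id + T] almost reaches [1 + r] must have [|f u|] close to [N], and rotating [u] by a
    unimodular scalar gives [z]. *)
Lemma daugavet_slice_neq0 f v (d eta : R) : daugavet_property re X ->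
  v != 0 -> dual_elt f -> 0 < d -> 0 < eta ->
  exists z, [/\ B z, forall u, B u -> re (f u) <= re (f z) + eta
    & nrm v + 1 - d <= nrm (v + z)].
Proof.
move=> DP v0 df d0 eta0; set r := nrm v; have r0 : 0 < r by exact: nrm_gt0.
(* If [f = 0], the operator is not rank one, but [z = v / r] works directly. *)
have [f0|/existsNP[w /eqP fw]] := pselect (forall x, f x = 0).
  exists (inc r^-1 *: v); split.
  - by rewrite /unit_ball /= nrm_normalize.
  - by move=> u _; rewrite !f0 rp0 add0r ltW.
  - rewrite -{1}[v]scale1r -{1}(rmorph1 inc) -scalerDl -rmorphD.
    rewrite nrmZ_ge0 ?(inc_ge0 hre) ?addr_ge0 ?invr_ge0 ?(ltW r0)// rp_inc.
    by rewrite mulrDl mul1r mulVf ?gt_eqF// -/r; lra.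
have [M M0 fM] := dual_elt_ball df.
have hs : has_sup [set nrm (f x : K^o) | x in B].
  exact: (@has_sup_ball K^o f M).
set N := sup [set nrm (f x : K^o) | x in B] in hs.
have fN x : B x -> re `|f x| <= N.
  by move=> Bx; apply: (sup_upper_bound hs); exists x.
have N0 : 0 < N.
  have w0 : w != 0.
    apply: contra_neq fw => ->.
    exact: (@is_linear0 X K^o f (proj1 df)).
  have := fN (inc (nrm w)^-1 *: w); rewrite /unit_ball /= nrm_normalize//.
  move=> /(_ (lexx _)); apply: lt_le_trans; apply: rp_gt0.
  rewrite normr_gt0 (dual_eltZ _ _ df) mulf_neq0//.
  by rewrite fmorph_eq0 invr_eq0 gt_eqF// nrm_gt0.
pose T u := (inc N^-1 * f u) *: v.
have nT u : nrm (T u) = N^-1 * re `|f u| * r.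
  by rewrite /T nrmZ normrM ger0_norm ?(rpM hre)// (inc_ge0 hre)// invr_ge0 ltW.
have lT : is_linear T.
  move=> a x y; rewrite /T (proj1 df) scalerA -scalerDl; congr (_ *: _); ring.
have bT : bounded_linear T.
  split=> // x; apply: (@cvgZr_tmp K X).
  by apply: (@cvgM K X); [exact: cvg_cst|exact: (proj2 df)].
have T1 : rank_one T.
  exists v => //; split=> [x|]; first by exists (inc N^-1 * f x).
  exists w; rewrite /T scaler_eq0 negb_or v0 andbT mulf_neq0//.
  by rewrite fmorph_eq0 invr_eq0 gt_eqF.
have hT : has_sup [set nrm (T x) | x in B].
  apply: (@has_sup_ball X T r) => x Bx; rewrite nT.
  by rewrite ler_piMl ?(ltW r0)// ler_pdivrMl// mulr1 fN.
have rT : r <= opnorm re T.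
  have : N <= opnorm re T * N / r.
    apply: ge_sup; first by case: hs.
    move=> _ [x Bx <-]; rewrite ler_pdivlMr// -ler_pdivrMr//.
    have <- : nrm (T x) = nrm (f x : K^o) * r / N.
      by rewrite nT /Defs.nrm; ring.
    by apply: (sup_upper_bound hT); exists x.
  by rewrite ler_pdivlMr// mulrC ler_pM2r.
have DPT := DP T bT T1.
(* The three bounds serve, in order, the norm estimate, near-maximality of [f], and [f u != 0]. *)
pose e := Num.min (d / 2) (Num.min (eta * r / N) r).
have e0 : 0 < e by rewrite !lt_min r0 !divr_gt0// mulr_gt0.
have [_ [u Bu <-] ule] : exists2 y, [set nrm (x + T x) | x in B] y & 1 + r - e < y.
  apply: sup_gt; first by exists (nrm (0 + T 0)), 0 => //; exact: unit_ball0.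
  by rewrite -/(opnorm re (fun x => x + T x)) DPT; lra.
set s := re `|f u| / N.
have s1 : s <= 1 by rewrite ler_pdivrMr// mul1r fN.
(* Triangle inequality: [1 + r - e < nrm (u + T u) <= 1 + s * r]. *)
have sr : r - e < s * r.
  have := nrmD u (T u); rewrite nT mulrC -/s [_^-1 * _]mulrC -/s.
  by move: Bu; rewrite /unit_ball /=; lra.
have [ed [ee er]] : e <= d / 2 /\ e <= eta * r / N /\ e <= r.
  by rewrite /e !ge_min !lexx !orbT.
have fu0 : f u != 0.
  apply: contraTneq sr => fu0.
  by rewrite /s fu0 normr0 rp0 !mul0r -leNgt subr_ge0.
(* The rotation making [f (w1 *: u)] equal to [|f u|]. *)
pose w1 := `|f u| / f u.
have w11 : `|w1| = 1 by rewrite normf_div normr_id divff// normr_eq0.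
exists (w1 *: u); split.
- by rewrite /unit_ball /= nrmZ w11 (rp1 hre) mul1r.
- move=> x Bx; rewrite (dual_eltZ _ _ df) /w1 divfK//.
  apply: (le_trans (rp_le_norm hre _)); apply: (le_trans (fN _ Bx)).
  have -> : re `|f u| = s * N by rewrite /s divfK// gt_eqF.
  rewrite -lerBlDl -{1}[N]mul1r -mulrBl -ler_pdivlMr// -(ler_pM2r r0).
  apply: (@le_trans _ _ e); first by lra.
  by rewrite mulrAC.
(* Since [w1 *: T u] is [s] times [v], the last term has norm [(1 - s) * r < e]; the total loss is
   below [2 * e <= d]. *)
- have -> : v + w1 *: u = w1 *: (u + T u) + inc (1 - s) *: v.
    rewrite scalerDr -addrA [LHS]addrC; congr (_ + _).
    rewrite /T scalerA -scalerDl -[LHS]scale1r; congr (_ *: _).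
    rewrite rmorphB rmorph1 /s rmorphM (rpK hre)// /w1.
    by move: (`|f u|) (inc _) (f u) fu0 => p q t t0; field.
  apply: (le_trans _ (nrmD_ge _ _)); rewrite nrmZ w11 (rp1 hre) mul1r.
  rewrite nrmZ_ge0 ?(inc_ge0 hre) ?subr_ge0// rp_inc.
  by rewrite mulrBl mul1r -/r; lra.
Qed.

Lemma daugavet_slice f v (d eta : R) : daugavet_property re X ->
  (exists x : X, x != 0) -> dual_elt f -> 0 < d -> 0 < eta ->
  exists z, [/\ B z, forall u, B u -> re (f u) <= re (f z) + eta
    & nrm v + 1 - d <= nrm (v + z)].
Proof.
move=> DP [x x0] df d0 eta0.
have [->|v0] := eqVneq v 0; last exact: daugavet_slice_neq0.
have [z [Bz fz xz]] := daugavet_slice_neq0 DP x0 df d0 eta0.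
by exists z; split=> //; rewrite nrm0 !add0r; have := nrmD x z; lra.
Qed.

(** Either an endpoint already lies in the interval, or [t <= a < b < s] and the weight is chosen to
    hit [b] exactly. *)
Lemma conv_in_itv (a b s t : R) : a < b -> a < s -> t <= b ->
  exists c, [/\ 0 <= c, c <= 1 & a < c * s + (1 - c) * t <= b].
Proof.
move=> ab as_ tb; have [sb|bs] := leP s b; first by exists 1; split=> //; lra.
have [at_|ta] := ltP a t; first by exists 0; split=> //; lra.
have st : 0 < s - t by lra.
exists ((b - t) / (s - t)); split.
- by rewrite divr_ge0; lra.
- by rewrite ler_pdivrMr// mul1r; lra.
- suff -> : (b - t) / (s - t) * s + (1 - (b - t) / (s - t)) * t = b by lra.
  by field; rewrite gt_eqF.
Qed.

(* With [F k := g + k tau h], let [k] be least such that [b < re (h z)] for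
   every near-maximizer [z] of [F k].  Comparing near-maximizers shows that the
   ones of [F (k - 2)] have [re (h z) <= re (h u)], so a convex combination of
   near-maximizers of [F k] and [F (k - 2)] has [b < re (h z) <= re (h u)] and
   nearly maximizes [F (k - 1)]. *)
Lemma daugavet_two_slices g h u v (a b d : R) : daugavet_property re X ->
  (exists x : X, x != 0) -> dual_elt g -> dual_elt h -> 0 < d ->
  B u -> a < re (g u) -> b < re (h u) ->
  exists z, [/\ B z, a < re (g z), b < re (h z)
    & nrm v + 1 - d <= nrm (v + z)].
Proof.
move=> DP nz dg dh d0 Bu agu bhu.
have [H H0 hH] := dual_elt_ball dh; have [G G0 gG] := dual_elt_ball dg.
have hb x : B x -> - H <= re (h x) <= H.
  move=> Bx; have := hH x Bx; have := rp_ge_norm (h x).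
  by have := rp_le_norm hre (h x); lra.
have gb x : B x -> - G <= re (g x) <= G.
  move=> Bx; have := gG x Bx; have := rp_ge_norm (g x).
  by have := rp_le_norm hre (g x); lra.
have [gam gam0 gamE] : exists2 r, 0 < r & r = re (g u) - a.
  by exists (re (g u) - a); rewrite ?subr_gt0.
have [del del0 delE] : exists2 r, 0 < r & r = re (h u) - b.
  by exists (re (h u) - b); rewrite ?subr_gt0.
(* A step of [tau] in the parameter changes [F] by at most [gam / 8] on the ball. *)
pose tau := gam / (8 * H); have tau0 : 0 < tau by rewrite divr_gt0// mulr_gt0.
have tauH : tau * H = gam / 8 by rewrite /tau; field; rewrite gt_eqF.
pose eta := Num.min (gam / 4) (tau * del / 4).
have eta0 : 0 < eta by rewrite lt_min !divr_gt0// mulr_gt0.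
have [eta1 eta2] : eta <= gam / 4 /\ eta <= tau * del / 4.
  by rewrite /eta !ge_min !lexx !orbT.
clearbody tau eta.
pose F (l : R) x := re (g x) + l * re (h x).
have FE (l : R) x : re (g x + inc l * h x) = F l x.
  by rewrite (rpD hre) (rpM hre).
pose nearmax (l : R) z := B z /\ forall x, B x -> F l x <= F l z + eta.
have [k Qk kmin] : exists2 k : nat,
    (forall z, nearmax (k%:R * tau) z -> b < re (h z))
    & (forall j, (j < k)%N ->
         exists2 z, nearmax (j%:R * tau) z & re (h z) <= b).
  pose Q (k : nat) := `[< forall z, nearmax (k%:R * tau) z -> b < re (h z) >].
  (* For large [k] the term in [h] dominates: a near-maximizer with [re (h z) <= b] would lose at
     least [k * tau * del] against [u], more than [2 * G + eta]. *)
  have exQ : exists k, Q k.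
    have [k Hk] : exists k : nat, (G + G + eta) / (tau * del) < k%:R.
      eexists; apply: archi_boundP.
      by rewrite ltW// divr_gt0 ?(mulr_gt0 tau0 del0)// !addr_gt0.
    exists k; apply/asboolP => z [Bz /(_ _ Bu)]; rewrite /F.
    move: Hk; rewrite ltr_pdivrMr ?(mulr_gt0 tau0 del0)// mulrA => Hk.
    have /andP[gu _] := gb _ Bu; have /andP[_ gz] := gb _ Bz; move=> Fz.
    rewrite ltNge; apply/negP => hz.
    have P1 : k%:R * tau * (re (h u) - b) <= k%:R * tau * (re (h u) - re (h z)).
      by rewrite ler_wpM2l ?mulr_ge0 ?ler0n ?(ltW tau0)//; lra.
    by rewrite delE in Hk; lra.
  case: (ex_minnP exQ) => k /asboolP Qk kmin; exists k => // j jk.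
  have : ~ forall z, nearmax (j%:R * tau) z -> b < re (h z).
    by move=> /asboolP/kmin; rewrite leqNgt jk.
  move=> /existsNP[z /not_implyP[nz' /negP]].
  by rewrite -leNgt; exists z.
have pick l w : exists2 z, nearmax l z & nrm w + 1 - d / 2 <= nrm (w + z).
  have [|z [Bz Fz wz]] := daugavet_slice w DP nz
    (dual_elt_comb l dg dh) _ eta0 (d := d / 2); first by rewrite divr_gt0.
  by exists z => //; split=> // x Bx; have := Fz x Bx; rewrite !FE.
case: k Qk kmin => [Q0 _|k Qk /(_ k (ltnSn k))[w [Bw Fw] hw]].
  have [z nz0 vz] := pick 0 v; exists z; have := Q0 z; rewrite mul0r.
  move=> /(_ nz0) hz; case: nz0 => Bz /(_ _ Bu); rewrite /F !mul0r !addr0.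
  by move=> Fz; split=> //; lra.
(* Now [k] is the predecessor of the least index: [w] shows the failure at [l], and [l + tau] is the
   least good parameter. [l - tau] may be negative, which [pick] allows. *)
set l := k%:R * tau in Fw; have l0 : 0 <= l by rewrite mulr_ge0 ?ler0n ?ltW.
have [z1 nz1 vz1] := pick (l + tau) v.
(* Choosing [z2] relative to [v + z1] makes [nrm (v + z1 + z2)] at least [nrm v + 2 - d]. *)
have [z2 [Bz2 Fz2] vz2] := pick (l - tau) (v + z1).
have hz1 : b < re (h z1) by apply: Qk; rewrite -addn1 natrD mulrDl mul1r.
have [Bz1 Fz1] := nz1.
have hz2 : re (h z2) <= re (h u).
  have := Fz2 _ Bw; have := Fw _ Bz2; rewrite /F !mulrBl => A1 A2.
  have : tau * (re (h z2) - re (h w)) <= tau * del by rewrite mulrBr; lra.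
  by rewrite ler_pM2l// delE; lra.
have [c [c0 c1 /andP[bc cu]]] := conv_in_itv bhu hz1 hz2.
exists (inc c *: z1 + inc (1 - c) *: z2).
rewrite !rp_dual_conv//; split=> //.
- exact: unit_ball_conv.
- have Fl (s : R) y : nearmax (l + s) y -> `|s| <= tau -> F l u - gam / 2 <= F l y.
    move=> [By /(_ _ Bu)]; rewrite /F !mulrDl => Fy xt.
    have P1 t : B t -> `|s * re (h t)| <= gam / 8.
      move=> /hb ht; rewrite normrM -tauH ler_pM//.
      by rewrite ler_norml.
    have := P1 _ By; have := P1 _ Bu; rewrite !ler_norml.
    by move=> /andP[? ?] /andP[? ?]; lra.
  have F1 : F l u - gam / 2 <= F l z1 by apply: (Fl tau) => //; rewrite gtr0_norm.
  have F2 : F l u - gam / 2 <= F l z2.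
    by apply: (Fl (- tau)) => //; rewrite normrN gtr0_norm.
  have F12 : F l u - gam / 2 <= c * F l z1 + (1 - c) * F l z2.
    have : c * (F l u - gam / 2) <= c * F l z1 by rewrite ler_wpM2l.
    have : (1 - c) * (F l u - gam / 2) <= (1 - c) * F l z2.
      by rewrite ler_wpM2l// subr_ge0.
    by lra.
  have : l * (c * re (h z1) + (1 - c) * re (h z2)) <= l * re (h u).
    by rewrite ler_wpM2l.
  have E : c * F l z1 + (1 - c) * F l z2 = c * re (g z1) + (1 - c) * re (g z2)
      + l * (c * re (h z1) + (1 - c) * re (h z2)) by rewrite /F; ring.
  by rewrite E /F in F12; lra.
(* The subtracted combination, with the weights swapped, lies in the ball and costs at most 1. *)
- have -> : v + (inc c *: z1 + inc (1 - c) *: z2)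
      = (v + z1 + z2) + - (inc (1 - c) *: z1 + inc c *: z2).
    rewrite rmorphB rmorph1 !scalerBl !scale1r opprD opprB -!addrA.
    congr (_ + _); rewrite (addrCA z1 z2) (addrCA z1 (_ *: _)) (addrA z1).
    by rewrite subrr add0r addrCA.
  apply: (le_trans _ (nrmD_ge _ _)); rewrite nrmN.
  have := @unit_ball_conv X z1 z2 (1 - c).
  rewrite subKr /unit_ball /= => /(_ _ _ Bz1 Bz2).
  have -> : 0 <= 1 - c by lra.
  have -> : 1 - c <= 1 by lra.
  by move=> /(_ isT isT); lra.
Qed.

End Daugavet.

(** * Convex combinations of a sequence, and narrowness of [T] *)

Section Main.
Variables X Y : normedModType K.
Local Notation nrm := (nrm re).
Local Notation B := (@unit_ball R K re X).

Lemma nrm_sum_ball n (c : 'I_n -> K) (z : 'I_n -> X) :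
  (forall i, 0 <= c i) -> (forall i, B (z i)) ->
  nrm (\sum_i c i *: z i) <= re (\sum_i c i).
Proof.
move=> c0 zB; apply: (le_trans (nrm_sum _ _ _)); rewrite rp_sum.
apply: ler_sum => i _; rewrite nrmZ_ge0// ler_piMr//; last exact: zB.
exact: (rp_ge0 hre).
Qed.

(* Passing from the convex combination to the full sum [z 0 + ... + z N] costs
   at most the total missing weight, which is [N]. *)
Lemma nrm_addr_conv (x : X) (z : nat -> X) (e : R) n (c : 'I_n -> K)
    (k : 'I_n -> nat) :
  (forall i, B (z i)) ->
  (forall N, N%:R + 1 - e <= nrm (x + \sum_(i < N) z i)) ->
  (forall i, 0 <= c i) -> \sum_i c i = 1 ->
  2 - e <= nrm (x + \sum_i c i *: z (k i)).
Proof.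
move=> zB xz c0 c1; pose N := (\max_i k i).+1.
have kN i : (k i < N)%N by rewrite ltnS (leq_bigmax i).
(* [k] may repeat values, so [d j] collects the weights of all [i] with [k i = j]. *)
pose p i := Ordinal (kN i); pose d j := \sum_(i | p i == j) c i.
have d0 j : 0 <= d j by exact: sumr_ge0.
have sumd : \sum_j d j = 1 by rewrite -c1 [RHS](partition_big p xpredT).
have d1 j : 0 <= 1 - d j.
  by rewrite -sumd (bigD1 j)//= addrAC subrr add0r sumr_ge0.
have -> : \sum_i c i *: z (k i) = \sum_(j < N) d j *: z j.
  rewrite (partition_big p xpredT)//=; apply: eq_bigr => j _.
  by rewrite scaler_suml; apply: eq_bigr => i /eqP <-.
have := xz N.
have -> : \sum_(i < N) z i =
    \sum_(j < N) d j *: z j + \sum_(j < N) (1 - d j) *: z j.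
  rewrite -big_split /=; apply: eq_bigr => j _.
  by rewrite -scalerDl addrC subrK scale1r.
rewrite addrA; have := nrmD (x + \sum_(j < N) d j *: z j)
  (\sum_(j < N) (1 - d j) *: z j).
have := nrm_sum_ball d1 (fun j => zB j).
rewrite big_split /= sumrN sumd sumr_const card_ord rpB (rp1 hre).
have -> : re (1 *+ N) = N%:R by rewrite -(rmorph_nat inc) rp_inc.
by lra.
Qed.

Lemma hereditary_SCD_narrow (T : X -> Y) : daugavet_property re X ->
  hereditary_SCD_operator re T -> narrow re T.
Proof.
move=> DP [bT hT] x y x1 y1 eps eps0 S [f [e [df e0 ->]]] [By].
set b0 := (X in X < _) => b0y.
have nz : exists x : X, x != 0.
  exists x; apply/eqP => x0; move: x1; rewrite x0 /unit_sphere /= nrm0.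
  by move=> /esym/eqP; rewrite oner_eq0.
(* The midpoint leaves room: weak bounds by [b] on convex combinations still give strict ones by
   [b0]. *)
pose b := (b0 + re (f y)) / 2.
have b0b : b0 < b by rewrite /b; lra.
have by_ : b < re (f y) by rewrite /b; lra.
pose S' := [set u : X | B u /\ b < re (f u)].
pose A := [set T u | u in S'].
have AB : A `<=` T @` B by move=> _ [u [Bu _] <-]; exists u.
have cA : Defs.convex_set A.
  move=> _ _ [u [Bu fu] <-] [v [Bv fv] <-] t t0 t1.
  have tE : t = inc (re t) by rewrite (rpK hre).
  have r0 : 0 <= re t by apply: (rp_ge0 hre).
  have r1 : re t <= 1 by rewrite -(rp1 hre) rp_le.
  exists (t *: u + (1 - t) *: v).
    rewrite tE -(rmorph1 inc) -rmorphB; split; first exact: unit_ball_conv.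
    rewrite rp_dual_conv// -subr_gt0.
    have [t00|t_gt0] := leP (re t) 0; first by have -> : re t = 0; lra.
    have : 0 < re t * (re (f u) - b) by rewrite mulr_gt0 ?subr_gt0.
    have : 0 <= (1 - re t) * (re (f v) - b).
      by rewrite mulr_ge0 ?subr_ge0// ltW.
    by lra.
  by rewrite (proj1 bT) (is_linearZ (proj1 bT)).
have [Sl [slS slA]] := hT A AB cA.
have Ay : A (T y) by exists y.
have pick n w : exists z, [/\ S' z, Sl n (T z)
    & nrm w + 1 - eps / 2 ^+ n.+1 <= nrm (w + z)].
  have [g [d [dg d0 ->]]] := slS n.
  have dgT := dual_elt_comp bT dg; have [M M0 gM] := dual_elt_ball dgT.
  have hs : has_sup [set re (g a) | a in A].
    split; first by exists (re (g (T y))), (T y).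
    exists M => _ [_ [u [Bu _] <-] <-].
    by apply: (le_trans _ (gM _ Bu)); apply: (rp_le_norm hre).
  (* A slice of [A] is nonempty, so some [u] in the ball satisfies both the bound on [g \o T] and
     the one on [f]. *)
  have [_ [_ [u [Bu fu] <-] <-] gu] := sup_adherent d0 hs.
  have [|z [Bz gz fz wz]] := daugavet_two_slices w DP nz dgT df _ Bu gu fu
    (d := eps / 2 ^+ n.+1); first by rewrite divr_gt0// exprn_gt0.
  by exists z; do !split=> //; exists z.
have [Z ZP] := choice (fun nw : nat * X => pick nw.1 nw.2).
(* Each new point depends on the partial sum so far, hence a choice function on pairs. *)
pose V := fix V n := if n is m.+1 then V m + Z (m, V m) else x.
pose z n := Z (n, V n).
have zS n : S' (z n) by case: (ZP (n, V n)).
have VE n : V n = x + \sum_(i < n) z i.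
  by elim: n => [|n IH]; rewrite ?big_ord0 ?addr0// big_ord_recr addrA -IH.
have Vn n : n%:R + 1 - eps + eps / 2 ^+ n <= nrm (V n).
  elim: n => [|n IH]; first by rewrite expr0 divr1 /= x1; lra.
  have [_ _] := ZP (n, V n); apply: le_trans => /=.
  have -> : eps / 2 ^+ n.+1 = (eps / 2 ^+ n) / 2.
    by rewrite exprSr invfM mulrA.
  by rewrite -addn1 natrD; lra.
(* The set of all [T (z n)] meets every determining slice, so [T y] is in its closed convex hull. *)
have [||w [n [c [t [c0 c1 tB ->]]]]] :=
    @closure_nrm Y _ (T y) eps (slA [set T (z n) | n in setT] _ _ _ Ay) eps0.
- by move=> _ [n _ <-]; exists (z n).
- move=> n; exists (T (z n)); split; first by exists n.
  by case: (ZP (n, V n)).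
move=> Tyw; have [k kt] := choice (fun i => let: ex_intro2 k _ E := tB i in
  ex_intro (fun k => T (z k) = t i) k E).
have TE : T (\sum_i c i *: z (k i)) = \sum_i c i *: t i.
  rewrite (is_linear_sum (proj1 bT)); apply: eq_bigr => i _.
  by rewrite (is_linearZ (proj1 bT)) kt.
exists (\sum_i c i *: z (k i)).
  split.
    rewrite /unit_ball /= -(rp1 hre) -c1; apply: nrm_sum_ball => // i.
    by case: (zS (k i)).
  rewrite -/b0 (lt_le_trans b0b)//.
  rewrite (@is_linear_sum X K^o f (proj1 df)) rp_sum -[b]mul1r -(rp1 hre) -c1.
  rewrite rp_sum mulr_suml; apply: ler_sum => i _.
  have -> : f (c i *: z (k i)) = inc (re (c i)) * f (z (k i)).
    by rewrite (dual_eltZ _ _ df) (rpK hre).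
  rewrite (rpM hre) ler_wpM2l ?(rp_ge0 hre)//.
  by case: (zS (k i)) => _ /ltW.
split; last by rewrite TE.
apply: nrm_addr_conv => // [i|N]; first by case: (zS i).
rewrite -VE; apply: (le_trans _ (Vn N)); rewrite lerDl.
by rewrite divr_ge0 ?exprn_ge0// ltW.
Qed.

End Main.

End Narrow.

(** * The real and the complex scalars *)

Lemma real_part_id (R : realType) :
  real_part (idfun : {rmorphism R -> R}) (@id R).
Proof. by split=> //= a; exact: ler_norm. Qed.

Lemma real_part_complex (R : realType) :
  real_part (@real_complex R : {rmorphism R -> R[i]}) (@complex.Re R).
Proof.
split=> //=.
- by case=> [a b] [c d].
- by move=> r [a b] /=; rewrite mul0r subr0.
- move=> a; have := normc_ge_Re a; rewrite lecE => /andP[_ /=].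
  exact/le_trans/ler_norm.
- by move=> a a0; rewrite RRe_real// ger0_real.
- by move=> a; rewrite lecE => /andP[].
- by move=> r r0; rewrite lecE /= eqxx.
Qed.

Unset Implicit Arguments.

(* Real case (K = R, re = id) and complex case (K = R[i], re = Re). *)
Theorem theorem5p11 (R : realType) :
  (forall (X Y : completeNormedModType R) (T : X -> Y),
     daugavet_property (@id R) X -> hereditary_SCD_operator (@id R) T ->
     narrow (@id R) T) /\
  (forall (X Y : completeNormedModType R[i]) (T : X -> Y),
     daugavet_property (@complex.Re R) X ->
     hereditary_SCD_operator (@complex.Re R) T ->
     narrow (@complex.Re R) T).
Proof.
split=> X Y T.
- exact: (hereditary_SCD_narrow (real_part_id R)).
- exact: (hereditary_SCD_narrow (real_part_complex R)).
Qed.
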